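(* Let $0<\varphi<\theta<1$ be constants, let $B_1,B_2,\dots$ be i.i.d. Bernoulli random variables with $\mathbb{P}(B_i=1)=\theta$, and let $\hat\Theta_n=\frac1n\sum_{i=1}^nB_i$. For each of $P=P_{\mathrm{CH},n}$, $P=P_{\mathrm{PBR},n}$ and $P=P_{\mathrm{X},n}$, $$\sqrt n\left(-\frac{\log P(\hat\Theta_n|\varphi)}{n}-\mathrm{KL}(\theta|\varphi)\right)\xrightarrow{D}N(0,\sigma_G^2),\qquad \sigma_G^2=\theta(1-\theta)\left(\log\Big(\frac{\theta}{1-\theta}\frac{1-\varphi}{\varphi}\Big)\right)^2,$$ where $\xrightarrow{D}$ denotes convergence in distribution and $N(\mu,\sigma^2)$ the normal distribution.
   Context: Logarithms are natural. $\mathrm{KL}(t|\varphi)=t\log(t/\varphi)+(1-t)\log\big((1-t)/(1-\varphi)\big)$. For an integer $n\ge1$, $0<\varphi<1$ and $t\in[0,1]$ with $nt$ an integer (convention $0^0=1$), define $P_{\mathrm{X},n}(t|\varphi)=\sum_{k\ge nt}\binom{n}{k}\varphi^k(1-\varphi)^{n-k}$; $P_{\mathrm{CH},n}(t|\varphi)=\left(\frac{\varphi}{t}\right)^{nt}\left(\frac{1-\varphi}{1-t}\right)^{n(1-t)}$ if $t\ge\varphi$, and $=1$ otherwise; $P_{\mathrm{PBR},n}(t|\varphi)=\varphi^{nt}(1-\varphi)^{n(1-t)}(n+1)\binom{n}{nt}$ if $t\ge\varphi$, and $=t^{nt}(1-t)^{n(1-t)}(n+1)\binom{n}{nt}$ otherwise.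 *)

(* Defs.v *)
From Stdlib Require Import Reals Arith.
Open Scope R_scope.

(* Throughout, t = k/n with k = n*t an integer in {0..n}; powers with natural
   exponents (x ^ 0 = 1, so 0^0 = 1 as in the paper's convention). *)

Definition KL (t phi : R) : R :=
  t * ln (t / phi) + (1 - t) * ln ((1 - t) / (1 - phi)).

Definition P_X (n k : nat) (phi : R) : R :=
  sum_f_R0 (fun j => if (k <=? j)%nat
                     then C n j * phi ^ j * (1 - phi) ^ (n - j) else 0) n.

Definition P_CH (n k : nat) (phi : R) : R :=
  let t := INR k / INR n in
  if Rle_dec phi t
  then (phi / t) ^ k * ((1 - phi) / (1 - t)) ^ (n - k)
  else 1.

Definition P_PBR (n k : nat) (phi : R) : R :=
  let t := INR k / INR n in
  if Rle_dec phi t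
  then phi ^ k * (1 - phi) ^ (n - k) * (INR n + 1) * C n k
  else t ^ k * (1 - t) ^ (n - k) * (INR n + 1) * C n k.

(* The statistic sqrt n ( -log P(k/n|phi)/n - KL(theta|phi) ) evaluated on the
   outcome n * Theta_hat_n = k. *)
Definition stat (P : nat -> nat -> R -> R) (n k : nat) (theta phi : R) : R :=
  sqrt (INR n) * (- ln (P n k phi) / INR n - KL theta phi).

(* CDF at x of the statistic, where n * Theta_hat_n = B_1+...+B_n ~ Binomial(n,theta). *)
Definition cdf_stat (P : nat -> nat -> R -> R) (n : nat) (theta phi x : R) : R :=
  sum_f_R0 (fun k => C n k * theta ^ k * (1 - theta) ^ (n - k)
                     * (if Rle_dec (stat P n k theta phi) x then 1 else 0)) n.

Definition normal_density (s2 t : R) : R :=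
  exp (- (t ^ 2) / (2 * s2)) / sqrt (2 * PI * s2).

Definition is_normal_cdf (s2 x l : R) : Prop :=
  forall eps, 0 < eps -> exists M0, forall M, M0 <= M ->
    exists pr : Riemann_integrable (normal_density s2) (- M) x,
      Rabs (RiemannInt pr - l) < eps.

(* Convergence in distribution of the statistic to N(0, s2): convergence of the
   CDFs at every point (N(0,s2), s2 > 0, has continuous CDF). *)
Definition conv_dist_normal (P : nat -> nat -> R -> R) (theta phi s2 : R) : Prop :=
  forall x, exists l, is_normal_cdf s2 x l /\
    Un_cv (fun m => cdf_stat P (S m) theta phi x) l.

Definition sigma_G2 (theta phi : R) : R :=
  theta * (1 - theta) * (ln (theta / (1 - theta) * ((1 - phi) / phi))) ^ 2.

(* Main.v *)
(** On [phi <= t < 1] each of the three values of [P] agrees up to a factor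
    [n + 1] with the exponential tilting ratio [exp (- n KL(t|phi))] (Chernoff's bound, and the
    fact that the mode of a binomial law has mass at least [1 / (n + 1)]). Since
    [KL(t|phi) = KL(theta|phi) + lambda (t - theta) + KL(t|theta)] exactly, where
    [lambda] is the log odds ratio and [KL(t|theta)] is at most the chi-square divergence,
    the statistic is [lambda sqrt n (t - theta)] up to an error that is uniformly
    small where [sqrt n (t - theta)] is bounded; Chebyshev's inequality handles the rest.

    The de Moivre-Laplace theorem is proved by Stein's method: for a Lipschitz
    approximation [h] of a step function, [f' (w) - w f (w) = h (w) - c] has a bounded
    solution, and the binomial identity
    [E ((K - n th) g (K)) = th E ((n - K) (g (K + 1) - g (K)))]
    turns the mean of the left-hand side into a [O(1 / sqrt n)]. *)

Require Import Defs.
From Stdlib Require Import Reals Lra Lia.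
From Coquelicot Require Import Coquelicot.
Open Scope R_scope.

(** * The Gaussian integral *)

Definition gauss (u : R) : R := exp (- (u ^ 2) / 2).
Definition gauss_int (x : R) : R := RInt gauss 0 x.
(** The integral of [gauss] over the positive half-line, as [gauss_int_lim] confirms. *)
Definition half_mass : R := sqrt (PI / 2).

Lemma exp_monotone (x y : R) : x <= y -> exp x <= exp y.
Proof.
  intros [H | ->]; [left; apply exp_increasing, H | right; reflexivity].
Qed.

Lemma gauss_pos (u : R) : 0 < gauss u.
Proof. apply exp_pos. Qed.

Lemma gauss_le_1 (u : R) : gauss u <= 1.
Proof.
  unfold gauss. rewrite <- exp_0. apply exp_monotone. nra.
Qed.

Lemma gauss_continuous (u : R) : continuous gauss u.
Proof. apply (ex_derive_continuous gauss). unfold gauss. auto_derive; auto. Qed.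

Lemma is_derive_gauss (u : R) : is_derive gauss u (- u * gauss u).
Proof. 
  unfold gauss. auto_derive; auto.
  replace (- (u * (u * 1)) * / 2) with (- u ^ 2 / 2) by field. field.
Qed.

Lemma gauss_ex_RInt (a b : R) : ex_RInt gauss a b.
Proof. apply (ex_RInt_continuous gauss). intros; apply gauss_continuous. Qed.

Lemma is_derive_RInt_of_continuous (f : R -> R) (a x : R) :
  (forall u, continuous f u) -> is_derive (fun y => RInt f a y) x (f x).
Proof.
  intros Hf. apply (is_derive_RInt f (fun y => RInt f a y) a); [|apply Hf].
  exists (mkposreal _ Rlt_0_1). intros y _. apply (RInt_correct f).
  apply (ex_RInt_continuous f). intros; apply Hf.
Qed.

Lemma is_derive_gauss_int (x : R) : is_derive gauss_int x (gauss x).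
Proof. apply is_derive_RInt_of_continuous, gauss_continuous. Qed.

Lemma MVT_point (f df : R -> R) (a b : R) :
  (forall x, is_derive f x (df x)) ->
  exists c, Rmin a b <= c <= Rmax a b /\ f b - f a = df c * (b - a).
Proof.
  intros H. destruct (MVT_gen f a b df) as [c Hc].
  - intros x _; apply H.
  - intros x _. apply continuity_pt_filterlim, (ex_derive_continuous f).
    eexists; apply H.
  - exists c; exact Hc.
Qed.

Lemma is_derive_nonneg_incr (f df : R -> R) (a b : R) :
  (forall x, is_derive f x (df x)) -> a <= b ->
  (forall x, a <= x <= b -> 0 <= df x) -> f a <= f b.
Proof.
  intros H Hab Hd. destruct (MVT_point f df a b H) as [c [Hc E]].
  rewrite Rmin_left, Rmax_right in Hc by lra.
  specialize (Hd c Hc). nra.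
Qed.

Lemma is_derive_0_const (f : R -> R) (a b : R) :
  (forall x, is_derive f x 0) -> f a = f b.
Proof.
  intros H. destruct (MVT_point f (fun _ => 0) a b H) as [c [Hc E]]. lra.
Qed.

Lemma gauss_int_0 : gauss_int 0 = 0.
Proof. apply (RInt_point 0 gauss). Qed.

Lemma gauss_int_opp (x : R) : gauss_int (- x) = - gauss_int x.
Proof.
  assert (H : gauss_int x + gauss_int (- x) = gauss_int 0 + gauss_int (- 0)).
  { apply (is_derive_0_const (fun x => gauss_int x + gauss_int (- x))).
    intros y. evar_last.
    - apply (is_derive_plus gauss_int (fun x => gauss_int (- x)) y).
      + apply is_derive_gauss_int.
      + apply (is_derive_comp gauss_int Ropp y (gauss (- y)) (- 1)).
        * apply is_derive_gauss_int.
        * auto_derive; auto.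
    - unfold gauss, plus, scal; simpl. unfold mult; simpl.
      replace (- (- y * (- y * 1)) / 2) with (- (y * (y * 1)) / 2) by field. ring. }
  rewrite Ropp_0, gauss_int_0 in H. lra.
Qed.

Lemma gauss_int_incr (x y : R) : x <= y -> gauss_int x <= gauss_int y.
Proof.
  intros H. apply (is_derive_nonneg_incr _ gauss); auto using is_derive_gauss_int.
  intros; left; apply gauss_pos.
Qed.

(** Integrand of the parameter trick for the Gaussian integral, scaled so that the [x]-derivative of
    its integral over [0, 1] cancels that of [gauss_int x ^ 2]. *)
Definition gauss_param (x t : R) : R := 2 * exp (- (x ^ 2 * (1 + t ^ 2)) / 2) / (1 + t ^ 2).

(** The summand [+ 0] gives the argument the affine form used by [RInt_comp_lin]. *)
Lemma is_derive_gauss_param (x t : R) :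
  is_derive (fun y => gauss_param y t) x (- 2 * gauss x * (x * gauss (x * t + 0))).
Proof.
  unfold gauss_param, gauss. auto_derive; [nra|].
  replace (- (x ^ 2 * (1 + t ^ 2)) / 2)
    with (- x ^ 2 / 2 + - (x * t + 0) ^ 2 / 2) by field.
  replace (- (x * (x * 1) * (1 + t * (t * 1))) * / 2)
    with (- x ^ 2 / 2 + - (x * t + 0) ^ 2 / 2) by field.
  rewrite exp_plus. field. nra.
Qed.

Lemma gauss_param_continuous (x t : R) : continuous (gauss_param x) t.
Proof.
  apply (ex_derive_continuous (gauss_param x)). unfold gauss_param. auto_derive. nra.
Qed.

Lemma gauss_param_ex_RInt (x : R) : ex_RInt (gauss_param x) 0 1.
Proof. apply (ex_RInt_continuous (gauss_param x)). intros; apply gauss_param_continuous. Qed.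

(** Differentiation under the integral sign, then the substitution [u = x t], which absorbs the
    factor [x]. *)
Lemma is_derive_RInt_gauss_param (x : R) :
  is_derive (fun y => RInt (gauss_param y) 0 1) x (- 2 * gauss x * gauss_int x).
Proof.
  evar_last.
  - apply (is_derive_RInt_param gauss_param 0 1 x).
    + exists (mkposreal _ Rlt_0_1). intros y _ t _. eexists. apply is_derive_gauss_param.
    + intros t _.
      apply continuity_2d_pt_ext with (fun u v => - 2 * gauss u * (u * gauss (u * v + 0))).
      { intros u v. symmetry. apply is_derive_unique, is_derive_gauss_param. }
      assert (Hg : forall z, continuity_pt gauss z).
      { intros z. apply continuity_pt_filterlim, gauss_continuous. }
      repeat first [ apply continuity_2d_pt_mult | apply continuity_2d_pt_plus
                   | apply continuity_2d_pt_const | apply continuity_2d_pt_id1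
                   | apply continuity_2d_pt_id2 | apply (continuity_1d_2d_pt_comp gauss); [apply Hg|] ].
    + exists (mkposreal _ Rlt_0_1). intros y _. apply gauss_param_ex_RInt.
  - transitivity (RInt (fun t => scal (- 2 * gauss x) (scal x (gauss (x * t + 0)))) 0 1).
    { apply RInt_ext. intros t _. apply is_derive_unique, is_derive_gauss_param. }
    rewrite (RInt_scal (fun t => scal x (gauss (x * t + 0)))).
    + etransitivity; [apply f_equal, (RInt_comp_lin gauss x 0 0 1), gauss_ex_RInt|].
      rewrite Rmult_0_r, Rmult_1_r, !Rplus_0_r. reflexivity.
    + apply (ex_RInt_comp_lin gauss), gauss_ex_RInt.
Qed.

(* The classical trick: both summands have opposite derivatives. *)
Lemma gauss_int_sqr (x : R) : gauss_int x ^ 2 + RInt (gauss_param x) 0 1 = PI / 2.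
Proof.
  rewrite (is_derive_0_const (fun x => gauss_int x ^ 2 + RInt (gauss_param x) 0 1) x 0).
  - rewrite gauss_int_0.
    (* At [x = 0] the integrand is [2 / (1 + t ^ 2)], with primitive [2 * atan]. *)
    assert (H : is_RInt (gauss_param 0) 0 1 (2 * atan 1 - 2 * atan 0)).
    { apply (is_RInt_derive (fun t => 2 * atan t)).
      - intros t _. unfold gauss_param.
        replace (- (0 ^ 2 * (1 + t ^ 2)) / 2) with 0 by field. rewrite exp_0.
        evar_last.
        + apply is_derive_scal. apply is_derive_Reals, derivable_pt_lim_atan.
        + unfold Rsqr. simpl. field. nra.
      - intros t _. apply gauss_param_continuous. }
    rewrite (is_RInt_unique _ _ _ _ H), atan_0, atan_1. field.
  - intros y. evar_last.
    + apply (is_derive_plus (fun x => gauss_int x ^ 2) (fun x => RInt (gauss_param x) 0 1)).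
      * apply (is_derive_pow gauss_int 2), is_derive_gauss_int.
      * apply is_derive_RInt_gauss_param.
    + unfold plus; simpl. ring.
Qed.

(** Makes the parametric integral vanish at infinity, so that [gauss_int_sqr] yields the limit of
    [gauss_int]. *)
Lemma RInt_gauss_param_bounds (x : R) : 0 <= RInt (gauss_param x) 0 1 <= 2 * gauss x.
Proof.
  assert (Hb : forall t, 0 <= gauss_param x t <= 2 * gauss x).
  { intros t. unfold gauss_param, gauss.
    assert (E : exp (- (x ^ 2 * (1 + t ^ 2)) / 2) <= exp (- x ^ 2 / 2)).
    { apply exp_monotone. assert (0 <= x ^ 2 * t ^ 2) by (apply Rmult_le_pos; apply pow2_ge_0). lra. }
    assert (H1 : 0 < / (1 + t ^ 2) <= 1).
    { assert (0 <= t ^ 2) by apply pow2_ge_0. split; [apply Rinv_0_lt_compat; lra|].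
      rewrite <- Rinv_1. apply Rinv_le_contravar; lra. }
    assert (H2 := exp_pos (- (x ^ 2 * (1 + t ^ 2)) / 2)).
    unfold Rdiv at 1 3. split; [|]; nra. }
  split.
  - apply RInt_ge_0; [lra|apply gauss_param_ex_RInt|]. intros; apply Hb.
  - replace (2 * gauss x) with (RInt (fun _ => 2 * gauss x) 0 1).
    + apply RInt_le; [lra|apply gauss_param_ex_RInt|apply ex_RInt_const|].
      intros; apply Hb.
    + rewrite RInt_const. unfold scal; simpl; unfold mult; simpl. ring.
Qed.

Lemma half_mass_pos : 0 < half_mass.
Proof. apply sqrt_lt_R0. assert (H := PI_RGT_0). lra. Qed.

Lemma half_mass_sqr : half_mass ^ 2 = PI / 2.
Proof. unfold half_mass. rewrite pow2_sqrt; [auto|]. assert (H := PI_RGT_0). lra. Qed.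

Lemma gauss_int_le_half_mass (x : R) : gauss_int x <= half_mass.
Proof.
  assert (H := gauss_int_sqr x). assert (H1 := RInt_gauss_param_bounds x).
  rewrite <- half_mass_sqr in H. assert (H2 := half_mass_pos).
  apply Rnot_lt_le; intros C. nra.
Qed.

Lemma gauss_small (eps : R) : 0 < eps -> exists M, 0 < M /\ forall x, M <= x -> gauss x <= eps.
Proof.
  (* From here on [x ^ 2 / 2 >= x >= / eps], and [exp y >= 1 + y]. *)
  intros He. exists (2 + 2 / eps). assert (0 < / eps) by (apply Rinv_0_lt_compat; auto).
  split; [unfold Rdiv; lra|]. intros x Hx.
  assert (H1 : / eps <= x ^ 2 / 2) by (unfold Rdiv in *; nra).
  assert (H2 : / eps < exp (x ^ 2 / 2)).
  { apply Rle_lt_trans with (1 := H1). assert (H2 := exp_ineq1_le (x ^ 2 / 2)). lra. }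
  unfold gauss. replace (- x ^ 2 / 2) with (- (x ^ 2 / 2)) by field.
  rewrite exp_Ropp, <- (Rinv_inv eps). apply Rinv_le_contravar; lra.
Qed.

Lemma gauss_int_lim (eps : R) : 0 < eps ->
  exists M, 0 < M /\ forall x, M <= x -> half_mass - eps <= gauss_int x.
Proof.
  intros He. assert (Hm := half_mass_pos).
  (* The product of [half_mass - gauss_int x] and [half_mass + gauss_int x] is at most
     [2 * gauss x]; the second factor is at least [half_mass]. *)
  destruct (gauss_small (half_mass * eps / 2)) as [M [HM H]]; [nra|].
  exists M. split; auto. intros x Hx. specialize (H x Hx).
  assert (E := gauss_int_sqr x). assert (H1 := RInt_gauss_param_bounds x).
  rewrite <- half_mass_sqr in E.
  assert (H2 : 0 <= gauss_int x) by (rewrite <- gauss_int_0; apply gauss_int_incr; lra).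
  assert (H3 := gauss_int_le_half_mass x). nra.
Qed.

(* Mills: [gauss - (half_mass - gauss_int)] decreases on [1, oo[ and tends to 0. *)
Lemma gauss_tail (w : R) : 1 <= w -> half_mass - gauss_int w <= gauss w.
Proof.
  intros Hw. apply Rnot_lt_le; intros C.
  (* Beyond [M] the tail is at most half the assumed excess at [w], against monotonicity. *)
  destruct (gauss_int_lim ((half_mass - gauss_int w - gauss w) / 2)) as [M [HM H]]; [lra|].
  assert (Hx := Rmax_l M w). assert (Hx' := Rmax_r M w). set (x := Rmax M w) in *.
  specialize (H x Hx).
  assert (D : - (gauss w + gauss_int w) <= - (gauss x + gauss_int x)).
  { apply (is_derive_nonneg_incr (fun w => - (gauss w + gauss_int w))
             (fun w => - (- w * gauss w + gauss w))); auto.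
    - intros y. apply (is_derive_opp (fun w => gauss w + gauss_int w)).
      apply (is_derive_plus gauss gauss_int); [apply is_derive_gauss|apply is_derive_gauss_int].
    - intros y Hy. assert (Hg := gauss_pos y). nra. }
  assert (Hg := gauss_pos x). lra.
Qed.

(** * Stein's equation *)

Definition normal_cdf (x : R) : R := (half_mass + gauss_int x) / (2 * half_mass).

Lemma normal_cdf_bounds (x : R) : 0 <= normal_cdf x <= 1.
Proof.
  assert (Hm := half_mass_pos). assert (H1 := gauss_int_le_half_mass x).
  assert (H2 := gauss_int_le_half_mass (- x)). rewrite gauss_int_opp in H2.
  unfold normal_cdf. split.
  - apply Rdiv_le_0_compat; lra.
  - apply Rle_div_l; lra.
Qed.

Lemma is_derive_normal_cdf (x : R) : is_derive normal_cdf x (gauss x / (2 * half_mass)).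
Proof.
  assert (Hm := half_mass_pos). evar_last.
  - apply (is_derive_ext (fun x => / (2 * half_mass) * (half_mass + gauss_int x))).
    { intros t. unfold normal_cdf. simpl. field. lra. }
    apply is_derive_scal.
    apply (is_derive_plus (fun _ => half_mass) gauss_int).
    + apply is_derive_const.
    + apply is_derive_gauss_int.
  - unfold plus, zero; simpl. field. lra.
Qed.

Lemma normal_cdf_lipschitz (x y : R) : x <= y -> normal_cdf y - normal_cdf x <= y - x.
Proof.
  intros H. destruct (MVT_point normal_cdf _ x y is_derive_normal_cdf) as [c [_ ->]].
  assert (Hm : 1 / 2 <= half_mass).
  { assert (Hm := half_mass_pos). assert (E := half_mass_sqr). assert (P := PI2_1). nra. }
  assert (Hg : gauss c / (2 * half_mass) <= 1).
  { apply Rle_div_l; [lra|]. assert (Hg := gauss_le_1 c). lra. }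
  nra.
Qed.

Lemma normal_cdf_lim_minus (eps : R) : 0 < eps ->
  exists M, 0 < M /\ forall x, x <= - M -> normal_cdf x <= eps.
Proof.
  intros He. assert (Hm := half_mass_pos).
  destruct (gauss_int_lim (eps * (2 * half_mass))) as [M [HM H]]; [nra|].
  exists M. split; auto. intros x Hx. specialize (H (- x) ltac:(lra)).
  rewrite gauss_int_opp in H. apply Rle_div_l; lra.
Qed.

(** A Lipschitz substitute for the indicator of a left half-line. Being constant outside [[x, T]],
    it leaves only integrals over bounded intervals in Stein's equation. *)
Definition soft_step (h : R -> R) (x T L : R) : Prop :=
  x <= T /\ (forall u, u <= x -> h u = 1) /\ (forall u, T <= u -> h u = 0) /\
  (forall u, 0 <= h u <= 1) /\ (forall u v, Rabs (h u - h v) <= L * Rabs (u - v)).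

Definition ramp (x eps u : R) : R := Rmin 1 (Rmax 0 ((x + eps - u) / eps)).

Lemma Rmin_Rmax_contract (a b : R) :
  Rabs (Rmin 1 (Rmax 0 a) - Rmin 1 (Rmax 0 b)) <= Rabs (a - b).
Proof.
  unfold Rmin, Rmax. repeat destruct Rle_dec; unfold Rabs; repeat destruct Rcase_abs; lra.
Qed.

Lemma ramp_soft_step (x eps : R) : 0 < eps -> soft_step (ramp x eps) x (x + eps) (/ eps).
Proof.
  intros He. assert (Hi := Rinv_0_lt_compat _ He). unfold ramp. repeat split.
  - lra.
  - intros u Hu. assert (1 <= (x + eps - u) / eps) by (apply Rle_div_r; lra).
    rewrite Rmax_right, Rmin_left; lra.
  - intros u Hu. assert ((x + eps - u) / eps <= 0) by (apply Rle_div_l; lra).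
    rewrite Rmax_left, Rmin_right; lra.
  - apply Rmin_glb; [lra|]. apply Rmax_l.
  - apply Rmin_l.
  - intros u v. eapply Rle_trans; [apply Rmin_Rmax_contract|].
    replace ((x + eps - u) / eps - (x + eps - v) / eps) with (- (/ eps * (u - v))) by (field; lra).
    rewrite Rabs_Ropp, Rabs_mult, (Rabs_pos_eq (/ eps)); lra.
Qed.

Lemma lipschitz_continuous (h : R -> R) (L : R) :
  (forall u v, Rabs (h u - h v) <= L * Rabs (u - v)) -> forall u, continuous h u.
Proof.
  intros H u. apply continuity_pt_filterlim. intros eps He. exists (eps / (Rabs L + 1)).
  assert (HL := Rabs_pos L). assert (HL' := Rle_abs L). split.
  - apply Rdiv_lt_0_compat; lra.
  - intros v [_ Hv]. simpl in *. unfold Rdist in *.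
    apply Rle_lt_trans with (1 := H v u).
    apply Rlt_div_r in Hv; [|lra]. assert (Hp := Rabs_pos (v - u)). nra.
Qed.

(** The standard normal mean of a soft step: all the mass left of [x] counts, none right of [T]. *)
Definition step_mean (h : R -> R) (x T : R) : R :=
  (half_mass + gauss_int x + RInt (fun u => h u * gauss u) x T) / (2 * half_mass).

(** For a soft step this is the integral of [(h - step_mean) * gauss] from minus infinity to [w];
    the first summand is the part left of [x], where [h = 1]. *)
Definition stein_num (h : R -> R) (x T w : R) : R :=
  (1 - step_mean h x T) * (half_mass + gauss_int x)
  + RInt (fun u => (h u - step_mean h x T) * gauss u) x w.

(* The integration constant in [stein_num] and the value [step_mean] make
   [stein_num] vanish at both infinities, which keeps [stein] bounded. *)
Definition stein (h : R -> R) (x T w : R) : R := stein_num h x T w * / gauss w.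

Lemma RInt_gauss (a b : R) : RInt gauss a b = gauss_int b - gauss_int a.
Proof.
  assert (H := RInt_Chasles gauss 0 a b (gauss_ex_RInt _ _) (gauss_ex_RInt _ _)).
  unfold plus in H; simpl in H. unfold gauss_int. lra.
Qed.

Lemma mult_gauss_continuous (h : R -> R) (u : R) :
  (forall u, continuous h u) -> continuous (fun u => h u * gauss u) u.
Proof. intros H. apply (continuous_mult h gauss); [apply H|apply gauss_continuous]. Qed.

Lemma mult_gauss_ex_RInt (h : R -> R) (a b : R) :
  (forall u, continuous h u) -> ex_RInt (fun u => h u * gauss u) a b.
Proof.
  intros H. apply (ex_RInt_continuous (fun u => h u * gauss u)). intros.
  now apply mult_gauss_continuous.
Qed.

Lemma RInt_const_gauss (c a b : R) :
  RInt (fun u => c * gauss u) a b = c * (gauss_int b - gauss_int a).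
Proof.
  rewrite <- RInt_gauss. apply (RInt_scal gauss). apply gauss_ex_RInt.
Qed.

(** A soft step lies between the indicators of the half-lines ending at [x] and at [T]. *)
Lemma step_mean_bounds (h : R -> R) (x T L : R) : soft_step h x T L ->
  normal_cdf x <= step_mean h x T <= normal_cdf T.
Proof.
  intros (HxT & _ & _ & H01 & HL). assert (Hc := lipschitz_continuous h L HL).
  assert (Hm := half_mass_pos).
  assert (H0 : 0 <= RInt (fun u => h u * gauss u) x T).
  { apply RInt_ge_0; auto using mult_gauss_ex_RInt. intros u _.
    apply Rmult_le_pos; [apply H01|left; apply gauss_pos]. }
  assert (H1 : RInt (fun u => h u * gauss u) x T <= RInt gauss x T).
  { apply RInt_le; auto using mult_gauss_ex_RInt, gauss_ex_RInt. intros u _.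
    assert (Hg := gauss_pos u). specialize (H01 u). nra. }
  rewrite RInt_gauss in H1. unfold normal_cdf, step_mean.
  split; apply Rmult_le_compat_r; try lra; left; apply Rinv_0_lt_compat; lra.
Qed.

Lemma stein_num_left (h : R -> R) (x T L w : R) : soft_step h x T L -> w <= x ->
  stein_num h x T w = (1 - step_mean h x T) * (half_mass + gauss_int w).
Proof.
  intros (HxT & H1 & _ & _ & _) Hw. unfold stein_num.
  rewrite (RInt_ext _ (fun u => (1 - step_mean h x T) * gauss u)), RInt_const_gauss.
  - ring.
  - intros u Hu. rewrite Rmax_left in Hu by lra. rewrite H1 by lra. reflexivity.
Qed.

(** The integral of [(h - step_mean) * gauss] over the whole line is 0, so the part up to [w] is
    minus the part beyond [w], where [h = 0]. *)
Lemma stein_num_right (h : R -> R) (x T L w : R) : soft_step h x T L -> T <= w ->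
  stein_num h x T w = step_mean h x T * (half_mass - gauss_int w).
Proof.
  intros (HxT & _ & H0 & _ & HL) Hw. assert (Hc := lipschitz_continuous h L HL).
  assert (Hm := half_mass_pos). unfold stein_num.
  assert (Hcc : forall c u, continuous (fun u => h u - c) u).
  { intros c u. apply (continuous_minus h (fun _ => c)); [apply Hc|apply continuous_const]. }
  assert (HC : RInt (fun u => (h u - step_mean h x T) * gauss u) x w
    = RInt (fun u => (h u - step_mean h x T) * gauss u) x T
      + RInt (fun u => (h u - step_mean h x T) * gauss u) T w).
  { symmetry. apply (RInt_Chasles (fun u => (h u - step_mean h x T) * gauss u));
      apply (mult_gauss_ex_RInt (fun u => h u - step_mean h x T)); apply Hcc. }
  assert (HM : RInt (fun u => (h u - step_mean h x T) * gauss u) x T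
    = RInt (fun u => h u * gauss u) x T - step_mean h x T * (gauss_int T - gauss_int x)).
  { rewrite <- RInt_const_gauss.
    transitivity (RInt (fun u => minus (h u * gauss u) (step_mean h x T * gauss u)) x T).
    - apply RInt_ext. intros u _. 
      change ((h u - step_mean h x T) * gauss u = h u * gauss u - step_mean h x T * gauss u). ring.
    - apply (RInt_minus (fun u => h u * gauss u) (fun u => step_mean h x T * gauss u)).
      + now apply mult_gauss_ex_RInt.
      + apply (mult_gauss_ex_RInt (fun _ => step_mean h x T)). intros; apply continuous_const. }
  assert (HR : RInt (fun u => (h u - step_mean h x T) * gauss u) T w
    = - step_mean h x T * (gauss_int w - gauss_int T)).
  { rewrite <- RInt_const_gauss. apply RInt_ext. intros u Hu.
    rewrite Rmin_left in Hu by lra. rewrite H0 by lra.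
    change ((0 - step_mean h x T) * gauss u = - step_mean h x T * gauss u). ring. }
  rewrite HC, HM, HR.
  assert (E : 2 * half_mass * step_mean h x T
    = half_mass + gauss_int x + RInt (fun u => h u * gauss u) x T).
  { unfold step_mean. field. lra. }
  nra.
Qed.

(** Stein's equation: [/ gauss] is the integrating factor, with derivative [w * / gauss w]. *)
Lemma is_derive_stein (h : R -> R) (x T L w : R) : soft_step h x T L ->
  is_derive (stein h x T) w (w * stein h x T w + h w - step_mean h x T).
Proof.
  intros (_ & _ & _ & _ & HL). assert (Hc := lipschitz_continuous h L HL).
  assert (Hg := gauss_pos w).
  assert (HN : is_derive (stein_num h x T) w ((h w - step_mean h x T) * gauss w)).
  { evar_last.
    - apply (is_derive_plus (fun _ => (1 - step_mean h x T) * (half_mass + gauss_int x))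
               (fun w => RInt (fun u => (h u - step_mean h x T) * gauss u) x w)).
      + apply is_derive_const.
      + apply (is_derive_RInt_of_continuous (fun u => (h u - step_mean h x T) * gauss u)).
        intros u. apply (mult_gauss_continuous (fun u => h u - step_mean h x T)).
        intros v. apply (continuous_minus h (fun _ => step_mean h x T)); [apply Hc|].
        apply continuous_const.
    - unfold plus, zero; simpl. ring. }
  evar_last.
  - apply (is_derive_mult (stein_num h x T) (fun w => / gauss w) w); [apply HN| |].
    + apply (is_derive_inv gauss); [apply is_derive_gauss|lra].
    + intros; apply Rmult_comm.
  - unfold stein, plus, mult; simpl. field. lra.
Qed.

(** Brings error terms in [Rabs w] to multiples of [1 + w ^ 2], whose mean is known from the
    variance. *)
Lemma quadratic_absorb (w : R) :
  Rabs w <= 1 + w ^ 2 /\ (Rabs w + 1) ^ 2 <= 2 * (1 + w ^ 2) /\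
  Rabs w * (Rabs w + 1) <= 2 * (1 + w ^ 2).
Proof.
  assert (H1 := pow2_ge_0 (w - 1)). assert (H2 := pow2_ge_0 (w + 1)). assert (H3 := pow2_ge_0 w).
  unfold Rabs; destruct Rcase_abs; repeat split; lra.
Qed.

(** Away from a compact interval the closed forms of [stein_num] and the bound [gauss_tail] give 1;
    on the interval continuity suffices. *)
Lemma stein_bounded (h : R -> R) (x T L : R) : soft_step h x T L ->
  exists C, forall w, Rabs (stein h x T w) <= C.
Proof.
  intros Hh. assert (Hb := step_mean_bounds _ _ _ _ Hh).
  assert (Hb1 := normal_cdf_bounds x). assert (Hb2 := normal_cdf_bounds T).
  assert (Hx := Rmin_l x (- 1)). assert (Hx1 := Rmin_r x (- 1)).
  assert (HT := Rmax_l T 1). assert (HT1 := Rmax_r T 1).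
  (* Maximizing the square bounds both signs at once, since [Rabs f <= 1 + f ^ 2]. *)
  destruct (continuity_ab_maj (fun w => stein h x T w ^ 2) (Rmin x (- 1)) (Rmax T 1))
    as [m [Hm _]]; [lra| |].
  { intros w _. apply continuity_pt_filterlim.
    apply (ex_derive_continuous (fun w => stein h x T w ^ 2)).
    eexists. apply (is_derive_pow (stein h x T) 2). eapply is_derive_stein, Hh. }
  assert (Htail : forall a w g, 0 <= a <= 1 -> 1 <= g -> gauss g = gauss w ->
            Rabs (a * (half_mass - gauss_int g) * / gauss w) <= 1).
  { intros a w g Ha Hg Eg. assert (Hp := gauss_pos w). assert (Ht := gauss_tail g Hg).
    assert (H0 := gauss_int_le_half_mass g). rewrite Eg in Ht.
    rewrite Rabs_pos_eq.
    - apply (Rle_div_l (a * (half_mass - gauss_int g)) 1 (gauss w)); [auto|]. nra.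
    - apply Rmult_le_pos; [nra|]. left. now apply Rinv_0_lt_compat. }
  exists (stein h x T m ^ 2 + 1). intros w. assert (H2 := pow2_ge_0 (stein h x T m)).
  destruct (Rle_dec w (Rmin x (- 1))) as [Hl|Hl]; [|destruct (Rle_dec (Rmax T 1) w) as [Hr|Hr]].
  - apply Rle_trans with 1; [|lra]. unfold stein. rewrite (stein_num_left _ _ _ _ _ Hh) by lra.
    replace (half_mass + gauss_int w) with (half_mass - gauss_int (- w))
      by (rewrite gauss_int_opp; ring).
    apply Htail; [lra|lra|]. unfold gauss. f_equal. field.
  - apply Rle_trans with 1; [|lra]. unfold stein. rewrite (stein_num_right _ _ _ _ _ Hh) by lra.
    apply Htail; [lra|lra|reflexivity].
  - assert (H := Hm w ltac:(lra)). cbv beta in H.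
    destruct (quadratic_absorb (stein h x T w)) as [Q _]. lra.
Qed.

(** Compares the derivative of [stein] with the weighted difference quotient produced by the
    binomial Stein identity, [d] being the lattice spacing of the z-scores. By the mean value
    theorem the quotient is the derivative at a point within [d] of [w]; no second derivative of
    [stein] is used. *)
Lemma stein_increment (h : R -> R) (x T L : R) : 0 <= L -> soft_step h x T L ->
  exists K, 0 <= K /\ forall th d w, 0 <= th <= 1 -> 0 < d <= 1 ->
    Rabs (w * stein h x T w + h w - step_mean h x T
          - (1 - th * d * w) * ((stein h x T (w + d) - stein h x T w) / d))
    <= d * K * (1 + w ^ 2).
Proof.
  intros HL0 Hh. destruct (stein_bounded _ _ _ _ Hh) as [C HC].
  set (f := stein h x T) in *. set (c := step_mean h x T) in *.
  set (f' := fun w => w * f w + h w - c).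
  assert (Df : forall w, is_derive f w (f' w)) by (intros w; eapply is_derive_stein, Hh).
  assert (Hc : 0 <= c <= 1).
  { assert (Hb := step_mean_bounds _ _ _ _ Hh). fold c in Hb.
    assert (Hb1 := normal_cdf_bounds x). assert (Hb2 := normal_cdf_bounds T). lra. }
  destruct Hh as (_ & _ & _ & H01 & HL).
  assert (C0 : 0 <= C) by (eapply Rle_trans; [apply Rabs_pos|apply (HC 0)]).
  (* By Stein's equation [f'] grows at most linearly. *)
  assert (B' : forall w v, Rabs (v - w) <= 1 -> Rabs (f' v) <= C * (Rabs w + 1) + 1).
  { intros w v Hv. unfold f'.
    replace (v * f v + h v - c) with (v * f v + (h v - c)) by ring.
    eapply Rle_trans; [apply Rabs_triang|]. rewrite Rabs_mult.
    assert (Rabs v <= Rabs w + 1).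
    { replace v with (w + (v - w)) by ring. eapply Rle_trans; [apply Rabs_triang|]. lra. }
    assert (Rabs (h v - c) <= 1) by (specialize (H01 v); apply Rabs_le; lra).
    assert (H1 := HC v). assert (H2 := Rabs_pos v). assert (H3 := Rabs_pos (f v)). nra. }
  (* By [quadratic_absorb]: [4 C] from the quadratic terms, [C + L] from the constants, [3] from
     [2 * Rabs w + 1]. *)
  exists (5 * C + L + 3). split; [lra|]. intros th d w Hth Hd.
  change (w * f w + h w - c) with (f' w).
  destruct (MVT_point f f' w (w + d) Df) as [v [Hv Ev]].
  rewrite Rmin_left, Rmax_right in Hv by lra.
  replace ((f (w + d) - f w) / d) with (f' v) by (rewrite Ev; field; lra).
  assert (Hvw : Rabs (v - w) <= d) by (apply Rabs_le; lra).
  assert (Hf : Rabs (f v - f w) <= d * (C * (Rabs w + 1) + 1)).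
  { destruct (MVT_point f f' w v Df) as [z [Hz ->]]. rewrite Rabs_mult.
    rewrite Rmin_left, Rmax_right in Hz by lra.
    assert (Bz := B' w z ltac:(apply Rabs_le; lra)).
    assert (H2 := Rabs_pos (v - w)). assert (H3 := Rabs_pos (f' z)). nra. }
  assert (Hf' : Rabs (f' w - f' v)
    <= d * ((Rabs w + 1) * (C * (Rabs w + 1) + 1) + C + L)).
  { unfold f'.
    replace (w * f w + h w - c - (v * f v + h v - c))
      with (- (v * (f v - f w)) + (- ((v - w) * f w) + - (h v - h w))) by ring.
    eapply Rle_trans; [apply Rabs_triang|].
    eapply Rle_trans; [apply Rplus_le_compat_l, Rabs_triang|].
    rewrite !Rabs_Ropp, !Rabs_mult.
    assert (Hv1 : Rabs v <= Rabs w + 1).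
    { replace v with (w + (v - w)) by ring. eapply Rle_trans; [apply Rabs_triang|]. lra. }
    assert (H1 : Rabs v * Rabs (f v - f w)
              <= (Rabs w + 1) * (d * (C * (Rabs w + 1) + 1)))
      by (apply Rmult_le_compat; auto using Rabs_pos).
    assert (H2 : Rabs (v - w) * Rabs (f w) <= d * C)
      by (apply Rmult_le_compat; auto using Rabs_pos).
    assert (H3 := HL v w). assert (H4 : L * Rabs (v - w) <= L * d) by nra. nra. }
  replace (f' w - (1 - th * d * w) * f' v) with ((f' w - f' v) + th * d * w * f' v) by ring.
  eapply Rle_trans; [apply Rabs_triang|].
  assert (H5 : Rabs (th * d * w * f' v) <= d * (Rabs w * (C * (Rabs w + 1) + 1))).
  { rewrite !Rabs_mult, (Rabs_pos_eq th), (Rabs_pos_eq d) by lra.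
    assert (Bv := B' w v ltac:(lra)). assert (Hp := Rabs_pos w).
    assert (H6 : Rabs w * Rabs (f' v) <= Rabs w * (C * (Rabs w + 1) + 1))
      by (apply Rmult_le_compat_l; auto).
    assert (H7 := Rabs_pos (f' v)). assert (H8 : 0 <= Rabs w * Rabs (f' v)) by nra.
    apply Rle_trans with (d * (Rabs w * Rabs (f' v))); [|nra].
    assert (0 <= d * (Rabs w * Rabs (f' v))) by nra. nra. }
  apply Rle_trans with (d * ((Rabs w + 1) * (C * (Rabs w + 1) + 1) + C + L
                             + Rabs w * (C * (Rabs w + 1) + 1))); [lra|].
  rewrite Rmult_assoc. apply Rmult_le_compat_l; [lra|].
  destruct (quadratic_absorb w) as (Q1 & Q2 & Q3).
  assert (Q0 : 1 <= 1 + w ^ 2) by nra.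
  assert (R1 : C * (Rabs w + 1) ^ 2 <= C * (2 * (1 + w ^ 2))) by (apply Rmult_le_compat_l; auto).
  assert (R2 : C * (Rabs w * (Rabs w + 1)) <= C * (2 * (1 + w ^ 2)))
    by (apply Rmult_le_compat_l; auto).
  assert (R3 : C * 1 <= C * (1 + w ^ 2)) by (apply Rmult_le_compat_l; auto).
  assert (R4 : L * 1 <= L * (1 + w ^ 2)) by (apply Rmult_le_compat_l; auto).
  lra.
Qed.

(** * The central limit theorem for the binomial law *)

Definition binom_pmf (n : nat) (th : R) (k : nat) : R :=
  Binomial.C n k * th ^ k * (1 - th) ^ (n - k).

Definition binom_mean (n : nat) (th : R) (F : nat -> R) : R :=
  sum_f_R0 (fun k => binom_pmf n th k * F k) n.

Lemma binom_coeff_pos (n k : nat) : 0 < Binomial.C n k.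
Proof.
  apply Rdiv_lt_0_compat; [apply INR_fact_lt_0|].
  apply Rmult_lt_0_compat; apply INR_fact_lt_0.
Qed.

Lemma binom_pmf_pos (n k : nat) (th : R) : 0 < th < 1 -> 0 < binom_pmf n th k.
Proof.
  intros H. apply Rmult_lt_0_compat; [apply Rmult_lt_0_compat|].
  - apply binom_coeff_pos.
  - apply pow_lt; lra.
  - apply pow_lt; lra.
Qed.

Lemma binom_pmf_sum (n : nat) (th : R) : sum_f_R0 (binom_pmf n th) n = 1.
Proof.
  rewrite <- (pow1 n). replace 1 with (th + (1 - th)) at 1 by ring.
  rewrite binomial. reflexivity.
Qed.

(** The ratio of consecutive masses, behind both Stein's identity and the location of the mode. *)
Lemma binom_pmf_S (n k : nat) (th : R) : (k < n)%nat ->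
  (1 - th) * INR (S k) * binom_pmf n th (S k) = th * (INR n - INR k) * binom_pmf n th k.
Proof.
  intros H. unfold binom_pmf. rewrite pascal_step3 by auto.
  replace (n - k)%nat with (S (n - S k)) by lia.
  replace (INR (S (n - S k))) with (INR n - INR k).
  - simpl pow. field. apply not_0_INR; lia.
  - rewrite <- minus_INR by lia. f_equal. lia.
Qed.

Lemma binom_mean_ext (n : nat) (th : R) (F G : nat -> R) :
  (forall k, (k <= n)%nat -> F k = G k) -> binom_mean n th F = binom_mean n th G.
Proof. intros H. apply sum_eq. intros k Hk. now rewrite H. Qed.

Lemma binom_mean_le (n : nat) (th : R) (F G : nat -> R) : 0 < th < 1 ->
  (forall k, (k <= n)%nat -> F k <= G k) -> binom_mean n th F <= binom_mean n th G.
Proof.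
  intros Ht H. apply sum_Rle. intros k Hk. apply Rmult_le_compat_l; auto.
  left; now apply binom_pmf_pos.
Qed.

Lemma binom_mean_lin (n : nat) (th a b : R) (F G : nat -> R) :
  binom_mean n th (fun k => a * F k + b * G k) = a * binom_mean n th F + b * binom_mean n th G.
Proof.
  unfold binom_mean. rewrite !scal_sum, <- sum_plus. apply sum_eq. intros; ring.
Qed.

Lemma binom_mean_const (n : nat) (th a : R) : binom_mean n th (fun _ => a) = a.
Proof.
  unfold binom_mean. rewrite <- scal_sum, binom_pmf_sum. ring.
Qed.

Lemma binom_mean_abs (n : nat) (th : R) (F : nat -> R) : 0 < th < 1 ->
  Rabs (binom_mean n th F) <= binom_mean n th (fun k => Rabs (F k)).
Proof.
  intros H. eapply Rle_trans; [apply Rsum_abs|]. right. apply sum_eq. intros k _.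
  rewrite Rabs_mult, Rabs_pos_eq; auto. left; now apply binom_pmf_pos.
Qed.

(** Summation by parts. The explicit boundary term carries the induction and vanishes at [m = n]. *)
Lemma binom_stein_partial (n m : nat) (th : R) (g : nat -> R) : (m <= n)%nat ->
  sum_f_R0 (fun k => binom_pmf n th k * ((INR k - INR n * th) * g k)) m
  + th * (INR n - INR m) * binom_pmf n th m * g (S m)
  = th * sum_f_R0 (fun k => binom_pmf n th k * ((INR n - INR k) * (g (S k) - g k))) m.
Proof.
  induction m as [|m IH]; intros H.
  - simpl. ring.
  - rewrite !tech5. specialize (IH ltac:(lia)).
    rewrite Rmult_plus_distr_l, <- IH.
    assert (E := binom_pmf_S n m th H).
    replace (th * (INR n - INR m) * binom_pmf n th m * g (S m))
      with ((1 - th) * INR (S m) * binom_pmf n th (S m) * g (S m)) by (rewrite E; ring).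
    ring.
Qed.

(* Stein's identity for the binomial law. *)
Lemma binom_stein (n : nat) (th : R) (g : nat -> R) :
  binom_mean n th (fun k => (INR k - INR n * th) * g k)
  = th * binom_mean n th (fun k => (INR n - INR k) * (g (S k) - g k)).
Proof.
  unfold binom_mean. rewrite <- binom_stein_partial by auto. ring.
Qed.

Definition zscore (n : nat) (th : R) (k : nat) : R :=
  (INR k - INR n * th) * / sqrt (INR n * (th * (1 - th))).

(** Stein's identity gives the mean for [g = 1] and the variance for [g k = k - n th]. *)
Lemma zscore_variance (n : nat) (th : R) : (0 < n)%nat -> 0 < th < 1 ->
  binom_mean n th (fun k => zscore n th k ^ 2) = 1.
Proof.
  intros Hn Ht. assert (HN : 0 < INR n) by (apply lt_0_INR; lia).
  assert (Hv : 0 < INR n * (th * (1 - th))) by (apply Rmult_lt_0_compat; nra).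
  assert (H1 : binom_mean n th (fun k => INR n - INR k) = INR n * (1 - th)).
  { assert (H := binom_stein n th (fun _ => 1)).
    rewrite (binom_mean_ext _ _ (fun k => (INR n - INR k) * (1 - 1)) (fun _ => 0)) in H
      by (intros; ring).
    rewrite (binom_mean_ext _ _ (fun k => (INR k - INR n * th) * 1)
               (fun k => INR n * (1 - th) * 1 + (- 1) * (INR n - INR k))) in H
      by (intros; ring).
    rewrite binom_mean_lin, !binom_mean_const in H. lra. }
  assert (H2 := binom_stein n th (fun k => INR k - INR n * th)). cbv beta in H2.
  rewrite (binom_mean_ext _ _ (fun k => _ * (INR (S k) - _ - _)) (fun k => INR n - INR k)), H1
    in H2 by (intros; rewrite S_INR; ring).
  rewrite (binom_mean_ext _ _ _ (fun k => / (INR n * (th * (1 - th)))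
      * ((INR k - INR n * th) * (INR k - INR n * th)) + 0 * 0)).
  - rewrite binom_mean_lin, H2, binom_mean_const. field. lra.
  - intros k _. unfold zscore. rewrite Rpow_mult_distr, pow_inv, pow2_sqrt by lra. ring.
Qed.

Lemma binom_clt_soft_step (h : R -> R) (x T L : R) : 0 <= L -> soft_step h x T L ->
  exists K, 0 <= K /\ forall n th, (0 < n)%nat -> 0 < th < 1 ->
    / sqrt (INR n * (th * (1 - th))) <= 1 ->
    Rabs (binom_mean n th (fun k => h (zscore n th k)) - step_mean h x T)
    <= K * / sqrt (INR n * (th * (1 - th))).
Proof.
  intros HL Hh. destruct (stein_increment h x T L HL Hh) as [K [HK H]].
  (* The 2 is the mean of [1 + w ^ 2]. *)
  exists (2 * K). split; [lra|]. intros n th Hn Ht Hd1.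
  assert (HN : 0 < INR n) by (apply lt_0_INR; lia).
  assert (Hv : 0 < INR n * (th * (1 - th))) by (apply Rmult_lt_0_compat; nra).
  assert (Var := zscore_variance n th Hn Ht).
  assert (Hd2 : (/ sqrt (INR n * (th * (1 - th)))) ^ 2 = / (INR n * (th * (1 - th))))
    by (rewrite pow_inv, pow2_sqrt; lra).
  assert (Hd : 0 < / sqrt (INR n * (th * (1 - th))))
    by (apply Rinv_0_lt_compat, sqrt_lt_R0; auto).
  unfold zscore in *. set (d := / sqrt (INR n * (th * (1 - th)))) in *.
  set (f := stein h x T) in *. set (c := step_mean h x T) in *.
  set (w := fun k => (INR k - INR n * th) * d) in *.
  assert (S1 := binom_stein n th (fun k => f (w k))). simpl in S1.
  assert (E : binom_mean n th (fun k => h (w k)) - c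
    (* By Stein's identity the terms added to [h (w k) - c] have mean 0. *)
    = binom_mean n th (fun k => w k * f (w k) + h (w k) - c
        - (1 - th * d * w k) * ((f (w k + d) - f (w k)) / d))).
  { rewrite (binom_mean_ext _ _ (fun k => w k * f (w k) + h (w k) - c - _)
     (fun k => 1 * (d * ((INR k - INR n * th) * f (w k)) + 1 * h (w k))
       + (- 1) * (1 * c + (d * th) * ((INR n - INR k) * (f (w (S k)) - f (w k)))))).
    - rewrite !binom_mean_lin, binom_mean_const, S1. ring.
    - intros k _. replace (w (S k)) with (w k + d) by (unfold w; rewrite S_INR; ring).
      (* Splits [n - k] as [n (1 - th) - (k - n th)] and uses [d ^ 2 = / (n th (1 - th))]. *)
      replace (1 - th * d * w k) with (d * d * (th * (INR n - INR k))).
      + unfold w. field. lra.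
      + unfold w. replace (th * d * ((INR k - INR n * th) * d))
          with (d ^ 2 * (th * (INR k - INR n * th))) by ring.
        replace (d * d) with (d ^ 2) by ring. rewrite Hd2. field. nra. }
  change (Rabs (binom_mean n th (fun k => h (w k)) - c) <= 2 * K * d).
  rewrite E. eapply Rle_trans; [now apply binom_mean_abs|].
  eapply Rle_trans.
  - apply binom_mean_le; auto. intros k _. apply H; lra.
  - rewrite (binom_mean_ext _ _ _ (fun k => d * K * 1 + d * K * w k ^ 2)) by (intros; ring).
    rewrite binom_mean_lin, binom_mean_const. change (fun k => w k ^ 2) with (fun k => ((INR k - INR n * th) * d) ^ 2). rewrite Var. lra.
Qed.

Lemma inv_sqrt_small (v eps : R) : 0 < v -> 0 < eps ->
  exists N, (0 < N)%nat /\ forall n, (N <= n)%nat -> / sqrt (INR n * v) <= eps.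
Proof.
  intros Hv He. destruct (INR_unbounded (/ (v * eps ^ 2))) as [N HN].
  assert (Hp : 0 < v * eps ^ 2) by (apply Rmult_lt_0_compat; [auto|apply pow_lt; auto]).
  exists (S N). split; [lia|]. intros n Hn. apply le_INR in Hn. rewrite S_INR in Hn.
  assert (H1 : (/ eps) ^ 2 <= INR n * v).
  { rewrite pow_inv. apply (Rmult_le_reg_l (/ v)); [now apply Rinv_0_lt_compat|].
    replace (/ v * (INR n * v)) with (INR n) by (field; lra).
    rewrite <- Rinv_mult. lra. }
  rewrite <- (Rinv_inv eps). assert (Hi := Rinv_0_lt_compat _ He).
  apply Rinv_le_contravar; auto.
  rewrite <- (sqrt_pow2 (/ eps)) by lra. now apply sqrt_le_1_alt.
Qed.

Lemma cdf_stat_binom_mean (P : nat -> nat -> R -> R) (n : nat) (theta phi x : R) :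
  cdf_stat P n theta phi x
  = binom_mean n theta (fun k => if Rle_dec (stat P n k theta phi) x then 1 else 0).
Proof. reflexivity. Qed.

(** The indicator of [stat <= x] is squeezed between two ramps in the z-score; z-scores beyond [A],
    where no linearization is assumed, are charged to [w ^ 2 / A ^ 2]. *)
Lemma clt_of_linearization (P : nat -> nat -> R -> R) (theta phi sigma x : R) :
  0 < theta < 1 -> 0 < sigma ->
  (forall A delta, 0 < A -> 0 < delta -> exists N, forall n k, (N <= n)%nat -> (0 < n)%nat ->
     (k <= n)%nat -> Rabs (zscore n theta k) <= A ->
     Rabs (stat P n k theta phi - sigma * zscore n theta k) <= delta) ->
  Un_cv (fun m => cdf_stat P (S m) theta phi x) (normal_cdf (x / sigma)).
Proof.
  intros Ht Hs Hlin eps He. set (y := x / sigma).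
  assert (Hy : x = sigma * y) by (unfold y; field; lra).
  (* Three errors of at most [eps / 4]: [2 * eta] from the ramps, one from their limit theorem, and
     [/ A ^ 2] from Chebyshev. *)
  set (eta := eps / 8). assert (Heta : 0 < eta) by (unfold eta; lra).
  assert (HL : 0 <= / eta) by (left; now apply Rinv_0_lt_compat).
  set (A := 1 + 4 / eps). assert (Hei := Rinv_0_lt_compat _ He).
  assert (HA : 0 < A) by (unfold A, Rdiv; lra).
  assert (HA2 : / A ^ 2 <= eps / 4).
  { replace (eps / 4) with (/ (4 / eps)) by (field; lra).
    assert (0 < 4 / eps) by (unfold Rdiv; lra).
    apply Rinv_le_contravar; [auto|]. unfold A. nra. }
  (* One ramp is still 1 at [y + eta], the other already 0 at [y - eta]: this margin absorbs a
     linearization error of [sigma * eta]. *)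
  assert (Ru := ramp_soft_step (y + eta) eta Heta).
  assert (Rl := ramp_soft_step (y - 2 * eta) eta Heta).
  destruct (binom_clt_soft_step _ _ _ _ HL Ru) as [K1 [HK1 CLTu]].
  destruct (binom_clt_soft_step _ _ _ _ HL Rl) as [K2 [HK2 CLTl]].
  destruct (Hlin A (sigma * eta) HA ltac:(nra)) as [N1 HN1].
  destruct (inv_sqrt_small (theta * (1 - theta)) (Rmin 1 (eps / 4 / (K1 + K2 + 1))))
    as [N2 [HN2p HN2]]; [nra| |].
  { apply Rmin_glb_lt; [lra|]. apply Rdiv_lt_0_compat; lra. }
  exists (N1 + N2)%nat. intros m Hm. rewrite cdf_stat_binom_mean.
  set (n := S m). assert (Hn : (0 < n)%nat) by (unfold n; lia).
  specialize (HN2 n ltac:(unfold n; lia)).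
  assert (Hd1 := Rle_trans _ _ _ HN2 (Rmin_l _ _)).
  assert (Hd2 := Rle_trans _ _ _ HN2 (Rmin_r _ _)).
  apply Rle_div_r in Hd2; [|lra].
  assert (Hd0 : 0 <= / sqrt (INR n * (theta * (1 - theta)))).
  { left. apply Rinv_0_lt_compat, sqrt_lt_R0, Rmult_lt_0_compat; [apply lt_0_INR; auto|nra]. }
  specialize (CLTu n theta Hn Ht Hd1). specialize (CLTl n theta Hn Ht Hd1).
  assert (Var := zscore_variance n theta Hn Ht).
  apply Rabs_le_between in CLTu. apply Rabs_le_between in CLTl.
  assert (Bu := step_mean_bounds _ _ _ _ Ru). assert (Bl := step_mean_bounds _ _ _ _ Rl).
  assert (Lu := normal_cdf_lipschitz y (y + eta + eta) ltac:(lra)).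
  assert (Ll := normal_cdf_lipschitz (y - 2 * eta) y ltac:(lra)).
  destruct Ru as (_ & Ru1 & _ & Ru2 & _). destruct Rl as (_ & _ & Rl0 & Rl2 & _).
  set (hu := ramp (y + eta) eta) in *. set (hl := ramp (y - 2 * eta) eta) in *.
  set (w := zscore n theta) in *.
  assert (Hout : forall k, A < Rabs (w k) -> 1 <= / A ^ 2 * w k ^ 2).
  { intros k Hk. rewrite <- (pow2_abs (w k)).
    assert (A ^ 2 <= Rabs (w k) ^ 2) by (apply pow_incr; lra).
    assert (0 < A ^ 2) by (apply pow_lt; auto). rewrite Rmult_comm.
    apply (Rle_div_r 1 (Rabs (w k) ^ 2) (A ^ 2)); lra. }
  assert (HAi : 0 < / A ^ 2) by (apply Rinv_0_lt_compat, pow_lt; auto).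
  assert (Hw2 : forall k, 0 <= / A ^ 2 * w k ^ 2).
  { intros k. apply Rmult_le_pos; [lra|apply pow2_ge_0]. }
  assert (U : binom_mean n theta (fun k => if Rle_dec (stat P n k theta phi) x then 1 else 0)
    <= binom_mean n theta (fun k => 1 * hu (w k) + / A ^ 2 * w k ^ 2)).
  { apply binom_mean_le; auto. intros k Hk. assert (H0 := Hw2 k). assert (H1 := Ru2 (w k)).
    destruct (Rle_dec (stat P n k theta phi) x) as [Hle|]; [|lra].
    destruct (Rle_lt_dec (Rabs (w k)) A) as [HwA|HwA]; [|assert (H2 := Hout k HwA); lra].
    assert (H2 := HN1 n k ltac:(unfold n; lia) Hn Hk HwA). apply Rabs_le_between in H2.
    fold w in H2. rewrite Ru1; [lra|]. apply (Rmult_le_reg_l sigma); lra. }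
  assert (Lo : binom_mean n theta (fun k => 1 * hl (w k) + (- / A ^ 2) * w k ^ 2)
    <= binom_mean n theta (fun k => if Rle_dec (stat P n k theta phi) x then 1 else 0)).
  { apply binom_mean_le; auto. intros k Hk. assert (H0 := Hw2 k). assert (H1 := Rl2 (w k)).
    destruct (Rle_dec (stat P n k theta phi) x) as [Hle|Hgt]; [lra|].
    destruct (Rle_lt_dec (Rabs (w k)) A) as [HwA|HwA]; [|assert (H2 := Hout k HwA); lra].
    assert (H2 := HN1 n k ltac:(unfold n; lia) Hn Hk HwA). apply Rabs_le_between in H2.
    fold w in H2. rewrite Rl0; [lra|].
    apply Rnot_lt_le; intros HC. apply (Rmult_lt_compat_l sigma) in HC; lra. }
  rewrite binom_mean_lin in U, Lo. rewrite Var in U, Lo.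
  unfold Rdist. fold y. apply Rabs_def1; unfold eta in *; nra.
Qed.

(** * The normal distribution function as an improper integral *)

Lemma is_RInt_normal_density (s a b : R) : 0 < s ->
  is_RInt (normal_density (s ^ 2)) a b (normal_cdf (b / s) - normal_cdf (a / s)).
Proof.
  intros Hs. assert (Hm := half_mass_pos).
  assert (E : forall t, normal_density (s ^ 2) t = / s * (gauss (t / s) / (2 * half_mass))).
  { intros t. unfold normal_density, gauss, half_mass.
    replace (2 * PI * s ^ 2) with ((2 * s) ^ 2 * (PI / 2)) by field.
    assert (Hp := PI_RGT_0). rewrite sqrt_mult, sqrt_pow2 by nra.
    replace (- t ^ 2 / (2 * s ^ 2)) with (- (t / s) ^ 2 / 2) by (field; lra).
    field. split; [apply Rgt_not_eq, sqrt_lt_R0|]; lra. }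
  assert (D : forall t, is_derive (fun t => normal_cdf (t / s)) t (normal_density (s ^ 2) t)).
  { intros t. rewrite E.
    apply (is_derive_comp normal_cdf (fun t => t / s) t); [apply is_derive_normal_cdf|].
    auto_derive; auto. ring. }
  apply (is_RInt_derive (fun t => normal_cdf (t / s))); [intros; apply D|].
  intros t _. apply (ex_derive_continuous (normal_density (s ^ 2))).
  unfold normal_density. auto_derive. nra.
Qed.

Lemma is_normal_cdf_normal_cdf (s x : R) : 0 < s ->
  is_normal_cdf (s ^ 2) x (normal_cdf (x / s)).
Proof.
  intros Hs eps He. destruct (normal_cdf_lim_minus (eps / 2) ltac:(lra)) as [M [HM H]].
  exists (M * s). intros N HN.
  assert (HI := is_RInt_normal_density s (- N) x Hs).
  exists (ex_RInt_Reals_0 _ _ _ (ex_intro _ _ HI)).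
  rewrite <- RInt_Reals, (is_RInt_unique _ _ _ _ HI).
  assert (HN' : M <= N / s) by (apply Rle_div_r; lra).
  specialize (H (- N / s)). assert (Hb := normal_cdf_bounds (- N / s)).
  replace (- N / s) with (- (N / s)) in * by (field; lra).
  specialize (H ltac:(lra)). apply Rabs_def1; lra.
Qed.

(** * Tail bounds and their logarithms *)

Lemma ln_le_sub_1 (x : R) : 0 < x -> ln x <= x - 1.
Proof. intros H. assert (E := exp_ineq1_le (ln x)). rewrite exp_ln in E by auto. lra. Qed.

(** Each summand obeys [a ln (a / b) >= a - b], and these lower bounds add up to 0. *)
Lemma KL_nonneg (t phi : R) : 0 < t < 1 -> 0 < phi < 1 -> 0 <= KL t phi.
Proof.
  intros Ht Hp. unfold KL.
  assert (H : forall a b, 0 < a -> 0 < b -> a - b <= a * ln (a / b)).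
  { intros a b Ha Hb. assert (Hq : 0 < b / a) by (apply Rdiv_lt_0_compat; auto).
    replace (a / b) with (/ (b / a)) by (field; lra). rewrite ln_Rinv by auto.
    assert (H := ln_le_sub_1 _ Hq). apply (Rmult_le_compat_l a) in H; [|lra].
    replace (a * (b / a - 1)) with (b - a) in H by (field; lra). lra. }
  assert (H1 := H t phi). assert (H2 := H (1 - t) (1 - phi)). lra.
Qed.

(** Applying [ln u <= u - 1] to both summands yields exactly the chi-square divergence. *)
Lemma KL_le_chi2 (t phi : R) : 0 < t < 1 -> 0 < phi < 1 ->
  KL t phi <= (t - phi) ^ 2 / (phi * (1 - phi)).
Proof.
  intros Ht Hp. unfold KL.
  assert (H : forall a b, 0 < a -> 0 < b -> a * ln (a / b) <= a * (a / b - 1)).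
  { intros a b Ha Hb. apply Rmult_le_compat_l; [lra|].
    apply ln_le_sub_1, Rdiv_lt_0_compat; auto. }
  assert (H1 := H t phi ltac:(lra) ltac:(lra)).
  assert (H2 := H (1 - t) (1 - phi) ltac:(lra) ltac:(lra)).
  replace ((t - phi) ^ 2 / (phi * (1 - phi)))
    with (t * (t / phi - 1) + (1 - t) * ((1 - t) / (1 - phi) - 1)) by (field; lra).
  lra.
Qed.

Definition log_odds_ratio (theta phi : R) : R := ln (theta / (1 - theta) * ((1 - phi) / phi)).

Lemma log_odds_ratio_pos (theta phi : R) : 0 < phi -> phi < theta -> theta < 1 ->
  0 < log_odds_ratio theta phi.
Proof.
  intros H1 H2 H3. unfold log_odds_ratio. rewrite <- ln_1. apply ln_increasing; [lra|].
  replace (theta / (1 - theta) * ((1 - phi) / phi))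
    with (theta * (1 - phi) / ((1 - theta) * phi)) by (field; lra).
  assert (0 < (1 - theta) * phi) by nra.
  apply Rlt_div_r; nra.
Qed.

(* The Bregman remainder of the first-order expansion of [KL _ phi] at [theta]
   is again a KL divergence. *)
Lemma KL_expansion (t theta phi : R) : 0 < t < 1 -> 0 < theta < 1 -> 0 < phi < 1 ->
  KL t phi = KL theta phi + log_odds_ratio theta phi * (t - theta) + KL t theta.
Proof.
  intros Ht Hth Hp. unfold KL, log_odds_ratio.
  assert (D : forall a b, 0 < a -> 0 < b -> ln (a / b) = ln a - ln b).
  { intros a b Ha Hb. unfold Rdiv.
    assert (Hi := Rinv_0_lt_compat _ Hb). rewrite ln_mult, ln_Rinv by auto. ring. }
  rewrite ln_mult by (apply Rdiv_lt_0_compat; lra).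
  rewrite !D by lra. ring.
Qed.

(** With [t = k / n], the mass does not decrease from [i] to [i + 1] exactly when [i + 1 <= k + t],
    that is when [i < k]. *)
Lemma binom_pmf_le_mode (n k j : nat) : (0 < k < n)%nat -> (j <= n)%nat ->
  binom_pmf n (INR k / INR n) j <= binom_pmf n (INR k / INR n) k.
Proof.
  intros Hk Hj. set (t := INR k / INR n).
  assert (HN : 0 < INR n) by (apply lt_0_INR; lia).
  assert (HK : 0 < INR k < INR n) by (split; [apply lt_0_INR|apply lt_INR]; lia).
  assert (Ht : 0 < t < 1).
  { unfold t. split; [apply Rdiv_lt_0_compat; lra|]. apply Rlt_div_l; lra. }
  assert (Hkt : INR k = t * INR n) by (unfold t; field; lra).
  assert (HS : forall i, 0 < (1 - t) * INR (S i)).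
  { intros i. apply Rmult_lt_0_compat; [lra|]. apply lt_0_INR; lia. }
  assert (Hb : forall i, 0 < binom_pmf n t i) by (intros; now apply binom_pmf_pos).
  assert (Up : forall i, (S i <= k)%nat -> binom_pmf n t i <= binom_pmf n t (S i)).
  { intros i Hi. assert (E := binom_pmf_S n i t ltac:(lia)). specialize (HS i). specialize (Hb i).
    apply (Rmult_le_reg_l _ _ _ HS). rewrite E. apply Rmult_le_compat_r; [lra|].
    apply le_INR in Hi. rewrite S_INR in *. nra. }
  assert (Down : forall i, (k <= i < n)%nat -> binom_pmf n t (S i) <= binom_pmf n t i).
  { intros i Hi. assert (E := binom_pmf_S n i t ltac:(lia)). specialize (HS i). specialize (Hb i).
    apply (Rmult_le_reg_l _ _ _ HS). rewrite E. apply Rmult_le_compat_r; [lra|].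
    destruct Hi as [Hi _]. apply le_INR in Hi. rewrite S_INR in *. nra. }
  destruct (Nat.le_gt_cases j k) as [H|H].
  - assert (G : forall i, (i <= k)%nat -> binom_pmf n t (k - i) <= binom_pmf n t k).
    { induction i as [|i IH]; intros Hi; [rewrite Nat.sub_0_r; lra|].
      eapply Rle_trans; [|apply IH; lia].
      replace (k - i)%nat with (S (k - S i)) by lia. apply Up. lia. }
    replace j with (k - (k - j))%nat by lia. apply G. lia.
  - assert (G : forall i, (k + i <= n)%nat -> binom_pmf n t (k + i) <= binom_pmf n t k).
    { induction i as [|i IH]; intros Hi; [rewrite Nat.add_0_r; lra|].
      eapply Rle_trans; [|apply IH; lia].
      rewrite Nat.add_succ_r. apply Down. lia. }
    replace j with (k + (j - k))%nat by lia. apply G. lia.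
Qed.

(** The [n + 1] masses sum to 1 and none exceeds the one at [k]. *)
Lemma binom_pmf_mode_ge (n k : nat) : (0 < k < n)%nat ->
  1 <= (INR n + 1) * binom_pmf n (INR k / INR n) k.
Proof.
  intros Hk. rewrite <- (binom_pmf_sum n (INR k / INR n)) at 1.
  rewrite <- S_INR, Rmult_comm, <- sum_cte. apply sum_Rle. intros j Hj.
  now apply binom_pmf_le_mode.
Qed.

Lemma term_le_sum (u : nat -> R) (n k : nat) :
  (forall j, 0 <= u j) -> (k <= n)%nat -> u k <= sum_f_R0 u n.
Proof.
  intros Hu. induction n as [|n IH]; intros Hk.
  - replace k with 0%nat by lia. simpl. lra.
  - rewrite tech5. destruct (Nat.eq_dec k (S n)) as [->|Hne].
    + assert (H := cond_pos_sum u n Hu). lra.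
    + specialize (IH ltac:(lia)). specialize (Hu (S n)). lra.
Qed.

Lemma binom_pmf_le_1 (n k : nat) (th : R) : 0 < th < 1 -> (k <= n)%nat -> binom_pmf n th k <= 1.
Proof.
  intros Ht Hk. rewrite <- (binom_pmf_sum n th). apply term_le_sum; auto.
  intros j. left. now apply binom_pmf_pos.
Qed.

Lemma pow_antitone (x : R) (m n : nat) : 0 <= x <= 1 -> (m <= n)%nat -> x ^ n <= x ^ m.
Proof.
  intros Hx Hmn. replace n with (m + (n - m))%nat by lia. rewrite pow_add.
  rewrite <- (Rmult_1_r (x ^ m)) at 2. apply Rmult_le_compat_l; [apply pow_le; lra|].
  rewrite <- (pow1 (n - m)). apply pow_incr; lra.
Qed.

(** The likelihood ratio of parameter [phi] to parameter [t] for a sample with [k] successes. *)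
Definition tilt (t phi : R) (n k : nat) : R :=
  (phi / t) ^ k * ((1 - phi) / (1 - t)) ^ (n - k).

Lemma tilt_pos (t phi : R) (n k : nat) : 0 < t < 1 -> 0 < phi < 1 -> 0 < tilt t phi n k.
Proof.
  intros Ht Hp.
  apply Rmult_lt_0_compat; apply pow_lt; apply Rdiv_lt_0_compat; lra.
Qed.

Lemma binom_pmf_tilt (t phi : R) (n k : nat) : 0 < t < 1 ->
  binom_pmf n phi k = tilt t phi n k * binom_pmf n t k.
Proof.
  intros Ht. unfold binom_pmf, tilt, Rdiv. rewrite !Rpow_mult_distr, !pow_inv.
  field. split; apply pow_nonzero; lra.
Qed.

(** For [phi <= t] each further success multiplies the ratio by [phi / t <= 1] and removes a factor
    [(1 - phi) / (1 - t) >= 1]. *)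
Lemma tilt_antitone (t phi : R) (n k j : nat) : 0 < phi -> phi <= t -> t < 1 -> (k <= j)%nat ->
  tilt t phi n j <= tilt t phi n k.
Proof.
  intros Hp Hpt Ht Hkj. unfold tilt.
  apply Rmult_le_compat; try (apply pow_le; left; apply Rdiv_lt_0_compat; lra).
  - apply pow_antitone; auto. split; [left; apply Rdiv_lt_0_compat|apply Rle_div_l]; lra.
  - apply Rle_pow; [|lia]. apply Rle_div_r; lra.
Qed.

Lemma ln_tilt (n k : nat) (phi : R) : (0 < k < n)%nat -> 0 < phi < 1 ->
  - ln (tilt (INR k / INR n) phi n k) / INR n = KL (INR k / INR n) phi.
Proof.
  intros Hk Hp. set (t := INR k / INR n).
  assert (HN : 0 < INR n) by (apply lt_0_INR; lia).
  assert (HK : 0 < INR k < INR n) by (split; [apply lt_0_INR|apply lt_INR]; lia).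
  assert (Ht : 0 < t < 1).
  { unfold t. split; [apply Rdiv_lt_0_compat; lra|]. apply Rlt_div_l; lra. }
  unfold tilt, KL.
  assert (H1 : 0 < t / phi) by (apply Rdiv_lt_0_compat; lra).
  assert (H2 : 0 < (1 - t) / (1 - phi)) by (apply Rdiv_lt_0_compat; lra).
  replace (phi / t) with (/ (t / phi)) by (field; lra).
  replace ((1 - phi) / (1 - t)) with (/ ((1 - t) / (1 - phi))) by (field; lra).
  assert (H3 := Rinv_0_lt_compat _ H1). assert (H4 := Rinv_0_lt_compat _ H2).
  rewrite ln_mult, !ln_pow, !ln_Rinv, minus_INR by (auto using pow_lt; lia).
  generalize (ln (t / phi)) (ln ((1 - t) / (1 - phi))). intros a b. unfold t. field. lra.
Qed.

(** With [r] the fourth root of [n], [n + 1 <= (2 r) ^ 4] gives [ln (n + 1) <= 8 r]; dividing by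
    [sqrt n = r ^ 2] leaves at most [(8 + A ^ 2) / r]. *)
Lemma ln_quartic_bound (n : nat) (A delta : R) : 0 < delta ->
  1 <= INR n -> ((8 + A ^ 2) / delta) ^ 4 <= INR n ->
  (ln (INR n + 1) + A ^ 2) / sqrt (INR n) <= delta.
Proof.
  intros Hd Hn H. set (r := sqrt (sqrt (INR n))).
  assert (Hr2 : r ^ 2 = sqrt (INR n)) by (unfold r; rewrite pow2_sqrt; auto; apply sqrt_pos).
  assert (Hr4 : r ^ 4 = INR n).
  { replace (r ^ 4) with ((r ^ 2) ^ 2) by ring. rewrite Hr2, pow2_sqrt; lra. }
  assert (Hr1 : 1 <= r).
  { unfold r. rewrite <- sqrt_1. apply sqrt_le_1_alt.
    rewrite <- sqrt_1. apply sqrt_le_1_alt. lra. }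
  assert (HL : ln (INR n + 1) <= 8 * r).
  { apply Rle_trans with (ln ((2 * r) ^ 4)).
    - apply ln_le; [lra|]. rewrite Rpow_mult_distr, Hr4. lra.
    - rewrite ln_pow by lra. assert (H1 := ln_le_sub_1 (2 * r) ltac:(lra)). simpl; lra. }
  assert (HR : (8 + A ^ 2) / delta <= r).
  { apply Rnot_lt_le; intros C. assert (E : r ^ 4 < ((8 + A ^ 2) / delta) ^ 4).
    { replace (r ^ 4) with (r ^ 2 * r ^ 2) by ring.
      replace (((8 + A ^ 2) / delta) ^ 4)
        with (((8 + A ^ 2) / delta) ^ 2 * ((8 + A ^ 2) / delta) ^ 2) by ring.
      assert (r ^ 2 < ((8 + A ^ 2) / delta) ^ 2) by nra. nra. }
    lra. }
  apply Rle_div_l in HR; [|lra]. rewrite <- Hr2. apply Rle_div_l; [nra|].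
  assert (HA := pow2_ge_0 A). nra.
Qed.

(** A factor [n + 1] shifts the statistic by at most [ln (n + 1) / sqrt n], which vanishes. Bounds
    for [phi <= k / n] suffice because a bounded z-score forces [k / n] close to [theta > phi]. *)
Lemma conv_dist_normal_of_tilt_bounds (P : nat -> nat -> R -> R) (phi theta : R) :
  0 < phi -> phi < theta -> theta < 1 ->
  (forall n k, (0 < k < n)%nat -> phi <= INR k / INR n ->
     tilt (INR k / INR n) phi n k <= (INR n + 1) * P n k phi /\
     P n k phi <= (INR n + 1) * tilt (INR k / INR n) phi n k) ->
  conv_dist_normal P theta phi (sigma_G2 theta phi).
Proof.
  intros Hp Hpt Ht HP x. set (v := theta * (1 - theta)). assert (Hv : 0 < v <= 1) by (unfold v; nra).
  assert (Hl := log_odds_ratio_pos theta phi Hp Hpt Ht).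
  set (sigma := sqrt v * log_odds_ratio theta phi).
  assert (Hsv : 0 < sqrt v) by (apply sqrt_lt_R0; lra).
  assert (Hs : 0 < sigma) by (apply Rmult_lt_0_compat; auto).
  assert (Es : sigma_G2 theta phi = sigma ^ 2).
  { unfold sigma. rewrite Rpow_mult_distr, pow2_sqrt by lra. reflexivity. }
  exists (normal_cdf (x / sigma)). split; [rewrite Es; now apply is_normal_cdf_normal_cdf|].
  apply clt_of_linearization; [lra|auto|]. intros A delta HA Hd.
  (* Within distance [m] of [theta], [t] stays strictly between [phi] and 1. *)
  set (m := Rmin (theta - phi) (1 - theta)).
  assert (Hm : 0 < m) by (apply Rmin_glb_lt; lra).
  assert (Hm1 : m <= theta - phi) by apply Rmin_l. assert (Hm2 : m <= 1 - theta) by apply Rmin_r.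
  (* As [v <= 1], [A * sqrt v / sqrt n <= A / sqrt (n v) <= m / 2]. *)
  destruct (inv_sqrt_small v (m / (2 * A))) as [N1 [_ HN1]]; [lra|apply Rdiv_lt_0_compat; lra|].
  destruct (INR_unbounded (((8 + A ^ 2) / delta) ^ 4)) as [N2 HN2].
  exists (N1 + N2)%nat. intros n k HnN Hn Hkn HwA.
  specialize (HN1 n ltac:(lia)).
  assert (HnR : ((8 + A ^ 2) / delta) ^ 4 <= INR n).
  { apply Rle_trans with (INR N2); [lra|]. apply le_INR; lia. }
  assert (Hn1 : 1 <= INR n) by (apply (le_INR 1); lia).
  assert (Herr := ln_quartic_bound n A delta Hd Hn1 HnR).
  set (w := zscore n theta k) in *. set (t := INR k / INR n).
  assert (Hsn : 0 < sqrt (INR n)) by (apply sqrt_lt_R0; lra).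
  assert (Hsn2 : sqrt (INR n) ^ 2 = INR n) by (apply pow2_sqrt; lra).
  assert (Hsv2 : sqrt v ^ 2 = v) by (apply pow2_sqrt; lra).
  assert (Ew : INR k - INR n * theta = w * (sqrt (INR n) * sqrt v)).
  { unfold w, zscore. fold v. rewrite sqrt_mult by lra. field. lra. }
  assert (Et : t - theta = w * (sqrt v / sqrt (INR n))).
  { unfold t. replace (INR k / INR n - theta) with ((INR k - INR n * theta) / INR n)
      by (field; lra).
    rewrite Ew. revert Hsn Hsn2. generalize (sqrt (INR n)). intros r Hr <-. field. lra. }
  assert (Htm : Rabs (t - theta) < m).
  { rewrite sqrt_mult in HN1 by lra. rewrite Et, Rabs_mult.
    rewrite (Rabs_pos_eq (sqrt v / sqrt (INR n))) by (left; apply Rdiv_lt_0_compat; auto).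
    assert (H1 : sqrt v / sqrt (INR n) <= m / (2 * A)).
    { apply Rle_trans with (/ (sqrt (INR n) * sqrt v)); auto.
      rewrite Rinv_mult. unfold Rdiv. rewrite Rmult_comm.
      apply Rmult_le_compat_l; [left; now apply Rinv_0_lt_compat|].
      rewrite <- (Rmult_1_l (/ sqrt v)). apply (Rle_div_r (sqrt v) 1 (sqrt v)); auto.
      rewrite <- (Rmult_1_r (sqrt v)) at 1. replace (sqrt v * sqrt v) with v by (rewrite <- Hsv2 at 1; ring).
      nra. }
    apply Rle_lt_trans with (A * (m / (2 * A))).
    - apply Rmult_le_compat; auto using Rabs_pos. left. apply Rdiv_lt_0_compat; auto.
    - replace (A * (m / (2 * A))) with (m / 2) by (field; lra). lra. }
  apply Rabs_lt_between in Htm.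
  assert (Ht01 : phi < t < 1) by lra.
  assert (HkR : INR k = t * INR n) by (unfold t; field; lra).
  assert (Hk : (0 < k < n)%nat).
  { split; apply INR_lt; rewrite HkR; simpl; nra. }
  destruct (HP n k Hk) as [HP1 HP2]; [fold t; lra|]. fold t in HP1, HP2.
  assert (HT := tilt_pos t phi n k ltac:(lra) ltac:(lra)).
  assert (HPp : 0 < P n k phi) by nra.
  assert (L1 : ln (tilt t phi n k) <= ln (INR n + 1) + ln (P n k phi)).
  { rewrite <- ln_mult by lra. apply ln_le; lra. }
  assert (L2 : ln (P n k phi) <= ln (INR n + 1) + ln (tilt t phi n k)).
  { rewrite <- ln_mult by lra. apply ln_le; lra. }
  assert (EKL := ln_tilt n k phi Hk ltac:(lra)). fold t in EKL.
  assert (Exp := KL_expansion t theta phi ltac:(lra) ltac:(lra) ltac:(lra)).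
  assert (K0 := KL_nonneg t theta ltac:(lra) ltac:(lra)).
  assert (K1 := KL_le_chi2 t theta ltac:(lra) ltac:(lra)). fold v in K1.
  (* An exact identity: the linear term of [KL_expansion], times [sqrt n], is [sigma * w]. *)
  assert (Edecomp : stat P n k theta phi - sigma * w
    = (ln (tilt t phi n k) - ln (P n k phi)) / sqrt (INR n) + sqrt (INR n) * KL t theta).
  { unfold stat, sigma.
    replace (KL t theta) with (- ln (tilt t phi n k) / INR n - KL theta phi
      - log_odds_ratio theta phi * (t - theta)) by lra.
    rewrite Et. revert Hsn Hsn2. clear. generalize (sqrt (INR n)). intros r Hr <-. field. lra. }
  rewrite Edecomp.
  (* The chi-square bound equals [w ^ 2 / n]. *)
  assert (Q : sqrt (INR n) * KL t theta <= A ^ 2 / sqrt (INR n)).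
  { apply Rle_trans with (sqrt (INR n) * ((t - theta) ^ 2 / v)).
    - apply Rmult_le_compat_l; lra.
    - rewrite Et. replace (sqrt (INR n) * ((w * (sqrt v / sqrt (INR n))) ^ 2 / v))
        with (w ^ 2 / sqrt (INR n)).
      2:{ revert Hsv Hsv2 Hsn. clear. generalize (sqrt v). intros r Hr <- Hsn. field. lra. }
      apply Rmult_le_compat_r; [left; now apply Rinv_0_lt_compat|].
      rewrite <- (pow2_abs w). apply pow_incr. split; auto using Rabs_pos. }
  assert (Q0 : 0 <= sqrt (INR n) * KL t theta) by (apply Rmult_le_pos; lra).
  assert (Hi := Rinv_0_lt_compat _ Hsn). unfold Rdiv in *.
  assert (M1 : (ln (tilt t phi n k) - ln (P n k phi)) * / sqrt (INR n)
    <= ln (INR n + 1) * / sqrt (INR n)) by (apply Rmult_le_compat_r; lra).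
  assert (M2 : - ln (INR n + 1) * / sqrt (INR n)
    <= (ln (tilt t phi n k) - ln (P n k phi)) * / sqrt (INR n))
    by (apply Rmult_le_compat_r; lra).
  assert (M3 : 0 <= A ^ 2 * / sqrt (INR n)) by (apply Rmult_le_pos; [apply pow2_ge_0|lra]).
  apply Rabs_le. lra.
Qed.

(** * Comparison of the three values with the tilting ratio *)

Lemma ratio_01 (n k : nat) : (0 < k < n)%nat -> 0 < INR k / INR n < 1.
Proof.
  intros Hk. assert (HK : 0 < INR k < INR n) by (split; [apply lt_0_INR|apply lt_INR]; lia).
  split; [apply Rdiv_lt_0_compat|apply Rlt_div_l]; lra.
Qed.

Lemma P_CH_tilt (n k : nat) (phi : R) : phi <= INR k / INR n ->
  P_CH n k phi = tilt (INR k / INR n) phi n k.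
Proof. intros H. unfold P_CH. destruct Rle_dec; [reflexivity|contradiction]. Qed.

Lemma P_PBR_binom_pmf (n k : nat) (phi : R) : phi <= INR k / INR n ->
  P_PBR n k phi = (INR n + 1) * binom_pmf n phi k.
Proof.
  intros H. unfold P_PBR. destruct Rle_dec; [|contradiction]. unfold binom_pmf. ring.
Qed.

Lemma P_X_ge_binom_pmf (n k : nat) (phi : R) : 0 < phi < 1 -> (k <= n)%nat ->
  binom_pmf n phi k <= P_X n k phi.
Proof.
  intros Hp Hk. unfold P_X.
  eapply Rle_trans; [|apply (term_le_sum _ n k); auto].
  - simpl. rewrite Nat.leb_refl. apply Rle_refl.
  - intros j. simpl. destruct (k <=? j)%nat; [|lra]. left. now apply (binom_pmf_pos n j).
Qed.

(** Chernoff's bound by change of measure: for [j >= k] the ratio is at most its value at [k], and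
    the masses under [t] sum to 1. *)
Lemma P_X_le_tilt (n k : nat) (phi : R) : (0 < k < n)%nat -> 0 < phi -> phi <= INR k / INR n ->
  P_X n k phi <= tilt (INR k / INR n) phi n k.
Proof.
  intros Hk Hp H. assert (Ht := ratio_01 n k Hk). set (t := INR k / INR n) in *.
  rewrite <- (Rmult_1_r (tilt t phi n k)), <- (binom_pmf_sum n t), scal_sum.
  apply sum_Rle. intros j Hj.
  assert (Hb := binom_pmf_pos n j t Ht). assert (Hpos := tilt_pos t phi n k Ht ltac:(lra)).
  destruct (Nat.leb_spec k j) as [Hkj|_]; [|nra].
  change (binom_pmf n phi j <= binom_pmf n t j * tilt t phi n k).
  rewrite (binom_pmf_tilt t) by auto. rewrite Rmult_comm.
  apply Rmult_le_compat_l; [lra|]. apply tilt_antitone; auto; lra.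
Qed.

Theorem theorem3 (phi theta : R) (Hphi : 0 < phi) (Hpt : phi < theta) (Ht1 : theta < 1) :
  conv_dist_normal P_CH theta phi (sigma_G2 theta phi) /\
  conv_dist_normal P_PBR theta phi (sigma_G2 theta phi) /\
  conv_dist_normal P_X theta phi (sigma_G2 theta phi).
Proof.
  repeat split; apply conv_dist_normal_of_tilt_bounds; auto; intros n k Hk H;
    assert (Ht := ratio_01 n k Hk); assert (HT := tilt_pos _ phi n k Ht ltac:(lra));
    assert (Hn : 0 < INR n) by (apply lt_0_INR; lia);
    assert (Hq := binom_pmf_pos n k phi ltac:(lra));
    (* The point mass at [k] lies between [tilt / (n + 1)] and [tilt], because the mass under
       [k / n] lies between [1 / (n + 1)] and 1; all three cases follow from this. *)
    assert (Hle : binom_pmf n phi k <= tilt (INR k / INR n) phi n k)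
      by (rewrite (binom_pmf_tilt _ phi n k Ht);
          assert (H1 := binom_pmf_le_1 n k _ Ht ltac:(lia)); nra);
    assert (Hge : tilt (INR k / INR n) phi n k <= (INR n + 1) * binom_pmf n phi k)
      by (rewrite (binom_pmf_tilt _ phi n k Ht);
          assert (H1 := binom_pmf_mode_ge n k Hk); nra).
  - rewrite P_CH_tilt by auto. nra.
  - rewrite P_PBR_binom_pmf by auto. nra.
  - assert (HX := P_X_le_tilt n k phi Hk Hphi H).
    assert (HX' := P_X_ge_binom_pmf n k phi ltac:(lra) ltac:(lia)). nra.
Qed.
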